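(* Let $X$ be any locally finite partially ordered set and let $R$ be any ring (with identity, not necessarily commutative). Then $$FS(I(X,\mathrm{Sing}_l(R))) \subseteq \mathrm{Sing}_l(I(X,R)) \subseteq I(X,\mathrm{Sing}_l(R)).$$
   Context: A partially ordered set $X$ is locally finite if every interval $[x,y]=\{z\in X: x\le z\le y\}$ is finite. The incidence ring $I(X,R)$ is the set of functions $f:X\times X\to R$ with $f(x,y)=0$ unless $x\le y$, with pointwise addition and product $(fg)(x,y)=\sum_{x\le z\le y} f(x,z)g(z,y)$. For an ideal $J$ of $R$, $I(X,J)$ denotes the set of $f\in I(X,R)$ all of whose values lie in $J$, and $FS(I(X,J))$ denotes the set of $f\in I(X,J)$ with finite support, i.e. $\{(x,y): f(x,y)\ne 0\}$ is finite. A left ideal of a ring is left essential if it intersects every nonzero left ideal nontrivially. For a ring $A$ and $a\in A$, $\mathrm{ann}_l(a)=\{b\in A: ba=0\}$, and the left singular ideal is $\mathrm{Sing}_l(A)=\{a\in A: \mathrm{ann}_l(a)\text{ is a left essential ideal of }A\}$ (a two-sided ideal). *)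

(* Defs.v *)
From HB Require Import structures.
From mathcomp Require Import all_boot all_order all_algebra finmap.
From mathcomp Require Import boolp classical_sets functions cardinality fsbigop.

Set Implicit Arguments.
Unset Strict Implicit.
Unset Printing Implicit Defensive.

Import Order.TTheory GRing.Theory.
Local Open Scope classical_set_scope.
Local Open Scope ring_scope.

HB.mixin Record isLocallyFinite d T of Order.POrder d T := {
  finite_interval : forall x y : T, finite_set [set z : T | (x <= z <= y)%O]
}.

#[short(type="lfPOrderType")]
HB.structure Definition LFPOrder d :=
  { T of Order.POrder d T & isLocallyFinite d T }.

(* [pzRingType] rather than [nzRingType]: the zero ring is allowed, and the
   incidence ring is itself the zero ring when X is empty. *)
Record incidence d (X : lfPOrderType d) (R : pzRingType) := Incidence {
  incidence_fun :> X -> X -> R;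
  incidenceP : forall x y, ~~ (x <= y)%O -> incidence_fun x y = 0
}.

Section IncidenceRing.
Context (d : Order.disp_t) (X : lfPOrderType d) (R : pzRingType).
Local Notation I := (incidence X R).
Implicit Types f g h : I.

HB.instance Definition _ := gen_eqMixin I.
HB.instance Definition _ := gen_choiceMixin I.

Lemma incidence_eqP f g : (forall x y, f x y = g x y) -> f = g.
Proof.
case: f g => [f Pf] [g Pg] /= fg.
have {}fg : f = g by apply/funext => x; apply/funext => y.
by subst g; congr Incidence; exact: Prop_irrelevance.
Qed.

Fact inc0_subproof x y : ~~ (x <= y :> X)%O -> (0 : R) = 0.
Proof. by []. Qed.
Definition inc0 : I := @Incidence _ X R (fun _ _ => 0) inc0_subproof.

Fact incN_subproof f x y : ~~ (x <= y)%O -> - f x y = 0.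
Proof. by move=> /(incidenceP f) ->; rewrite oppr0. Qed.
Definition incN f : I := Incidence (@incN_subproof f).

Fact incD_subproof f g x y : ~~ (x <= y)%O -> f x y + g x y = 0.
Proof. by move=> xy; rewrite !incidenceP// addr0. Qed.
Definition incD f g : I := Incidence (@incD_subproof f g).

Fact incDA : associative incD.
Proof. by move=> f g h; apply: incidence_eqP => x y /=; rewrite addrA. Qed.
Fact incDC : commutative incD.
Proof. by move=> f g; apply: incidence_eqP => x y /=; rewrite addrC. Qed.
Fact inc0D : left_id inc0 incD.
Proof. by move=> f; apply: incidence_eqP => x y /=; rewrite add0r. Qed.
Fact incND : left_inverse inc0 incN incD.
Proof. by move=> f; apply: incidence_eqP => x y /=; rewrite addNr. Qed.

HB.instance Definition _ := GRing.isZmodule.Build I incDA incDC inc0D incND.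

Fact inc1_subproof x y : ~~ (x <= y :> X)%O -> (x == y)%:R = 0 :> R.
Proof. by case: eqVneq => [->|//]; rewrite lexx. Qed.
Definition inc1 : I := Incidence inc1_subproof.

(* The interval is finite, so this [\sum_(_ \in _)] never takes its default
   value 0 for sums of infinite support. *)
Definition convolution f g (x y : X) : R :=
  \sum_(z \in [set z : X | (x <= z <= y)%O]) f x z * g z y.

Fact incM_subproof f g x y : ~~ (x <= y)%O -> convolution f g x y = 0.
Proof.
move=> xy; apply: fsbig1 => z /= /andP[xz zy].
by rewrite (le_trans xz zy) in xy.
Qed.
Definition incM f g : I := Incidence (@incM_subproof f g).

Definition interval_seq (x y : X) : seq X :=
  fset_set [set z : X | (x <= z <= y)%O].

Lemma mem_interval_seq x y z : (z \in interval_seq x y) = (x <= z <= y)%O.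
Proof.
rewrite /interval_seq in_fset_set; last exact: finite_interval.
by apply/idP/idP; rewrite inE.
Qed.

Lemma interval_seq_uniq x y : uniq (interval_seq x y).
Proof. exact: fset_uniq. Qed.

Lemma convolutionE f g x y x' y' : (x' <= x)%O -> (y <= y')%O ->
  convolution f g x y = \sum_(z <- interval_seq x' y') f x z * g z y.
Proof.
move=> xx yy; apply: fsbig_fwiden.
- move=> z /= /andP[xz zy].
  by rewrite mem_interval_seq (le_trans xx xz) (le_trans zy yy).
- exact: interval_seq_uniq.
- move=> z [_ /negP]; rewrite negb_and => /orP[] /incidenceP /= ->.
    by rewrite mul0r.
  by rewrite mulr0.
Qed.

Fact incMA : associative incM.
Proof.
move=> f g h; apply: incidence_eqP => x y.
rewrite /= !(convolutionE _ _ (lexx x) (lexx y)).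
rewrite [LHS](_ : _ = \sum_(z <- interval_seq x y)
    \sum_(w <- interval_seq x y) f x z * g z w * h w y); last first.
  rewrite [LHS]big_seq_cond [RHS]big_seq_cond; apply: eq_bigr => z.
  rewrite mem_interval_seq andbT => /andP[xz zy] /=.
  rewrite (convolutionE _ _ xz (lexx y)) big_distrr /=.
  by apply: eq_bigr => w _; rewrite mulrA.
rewrite exchange_big /= [LHS]big_seq_cond [RHS]big_seq_cond.
apply: eq_bigr => w; rewrite mem_interval_seq andbT => /andP[xw wy] /=.
by rewrite (convolutionE _ _ (lexx x) wy) big_distrl.
Qed.

Fact inc1M : left_id inc1 incM.
Proof.
move=> f; apply: incidence_eqP => x y /=.
have [xy|xy] := boolP (x <= y)%O; last by rewrite incM_subproof// incidenceP.
rewrite (convolutionE _ _ (lexx x) (lexx y)).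
rewrite (bigD1_seq x) ?mem_interval_seq ?lexx ?interval_seq_uniq//=.
rewrite eqxx mul1r big1 ?addr0// => z zx.
by rewrite eq_sym (negbTE zx) mul0r.
Qed.

Fact incM1 : right_id inc1 incM.
Proof.
move=> f; apply: incidence_eqP => x y /=.
have [xy|xy] := boolP (x <= y)%O; last by rewrite incM_subproof// incidenceP.
rewrite (convolutionE _ _ (lexx x) (lexx y)).
rewrite (bigD1_seq y) ?mem_interval_seq ?lexx ?andbT ?interval_seq_uniq//=.
by rewrite eqxx mulr1 big1 ?addr0// => z zy; rewrite (negbTE zy) mulr0.
Qed.

Fact incMDl : left_distributive incM incD.
Proof.
move=> f g h; apply: incidence_eqP => x y /=.
rewrite !(convolutionE _ _ (lexx x) (lexx y)) -big_split /=.
by apply: eq_bigr => z _; rewrite mulrDl.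
Qed.

Fact incMDr : right_distributive incM incD.
Proof.
move=> f g h; apply: incidence_eqP => x y /=.
rewrite !(convolutionE _ _ (lexx x) (lexx y)) -big_split /=.
by apply: eq_bigr => z _; rewrite mulrDr.
Qed.

HB.instance Definition _ :=
  GRing.Zmodule_isPzRing.Build I incMA inc1M incM1 incMDl incMDr.

End IncidenceRing.

Section LeftSingularIdeal.
Context (A : pzRingType).

Definition left_ideal (I : set A) : Prop :=
  [/\ I 0,
      forall a b, I a -> I b -> I (a + b)
    & forall r a, I a -> I (r * a)].

Definition left_essential (I : set A) : Prop :=
  left_ideal I /\
  forall J : set A, left_ideal J -> J <> [set 0] -> I `&` J <> [set 0].

Definition annl (a : A) : set A := [set b | b * a = 0].

Definition Singl : set A := [set a | left_essential (annl a)].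

End LeftSingularIdeal.
Arguments Singl A : clear implicits.

Section IncidenceSubsets.
Context (d : Order.disp_t) (X : lfPOrderType d) (R : pzRingType).

Definition incidence_in (J : set R) : set (incidence X R) :=
  [set f | forall x y, J (f x y)].

Definition incidence_support (f : incidence X R) : set (X * X) :=
  [set p | f p.1 p.2 != 0].

Definition FS (S : set (incidence X R)) : set (incidence X R) :=
  [set f | S f /\ finite_set (incidence_support f)].

End IncidenceSubsets.
Arguments incidence_in {d} X {R} J.

(* Main.v *)
Require Import Defs.
From mathcomp Require Import all_boot all_order all_algebra.
From mathcomp Require Import classical_sets.
From mathcomp Require Import boolp cardinality.

Import Order.TTheory GRing.Theory.

Local Open Scope classical_set_scope.

(** [a] is left singular iff every [b != 0] has a multiple [r b != 0] with
    [r b a = 0].  For the second inclusion, test [f] against [b e_xx]: a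
    nonzero entry [g u x * b] of a multiple annihilating [f] kills [f x y].
    For the first, take [h] with nonzero row [u].  The finitely many nonzero
    entries [f w y] are treated one after the other: either the current left
    multiple of the row vanishes at [w], or singularity of [f w y] gives a
    further multiple that is nonzero at [w] and kills [f w y] there.  The column
    witnessing that the row is nonzero thus changes during the process. *)

Local Open Scope ring_scope.

Lemma left_ideal_annl (A : pzRingType) (a : A) : left_ideal (annl a).
Proof.
split=> [|b c|r b]; rewrite /annl /= ?mul0r//.
- by move=> ba ca; rewrite mulrDl ba ca addr0.
- by move=> ba; rewrite -mulrA ba mulr0.
Qed.

(** Essentiality need only be tested on principal left ideals [A b], because every nonzero left
    ideal contains a nonzero one of these. *)
Lemma SinglP (A : pzRingType) (a : A) :
  Singl A a <-> forall b, b != 0 -> exists2 r, r * b != 0 & r * b * a = 0.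
Proof.
split=> [[_ ess] b b0|sing].
- apply: contrapT => nr.
  have idealJ : left_ideal (range (fun r => r * b)).
    split; first by exists 0; rewrite ?mul0r.
    + by move=> _ _ [r _ <-] [s _ <-]; exists (r + s); rewrite ?mulrDl.
    + by move=> s _ [r _ <-]; exists (s * r); rewrite ?mulrA.
  apply: (ess _ idealJ).
    move=> J0; have : range (fun r => r * b) b by exists 1; rewrite ?mul1r.
    by rewrite J0 => /= /eqP; apply/negP.
  apply/seteqP; split=> [c [ca [r _ rbc]]|_ ->] /=; last first.
    by split; [rewrite /annl /= mul0r | case: idealJ].
  subst c; apply: contrapT => /eqP rb0; apply: nr.
  by exists r.
- split=> [|J [J0 _ JM] JN0 E]; first exact: left_ideal_annl.
  apply: JN0; apply/seteqP; split=> [b Jb|_ ->] //=.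
  apply: contrapT => /eqP /sing[r rb0 rba].
  have : (annl a `&` J) (r * b) by split=> //; exact: JM.
  by rewrite E /= => /eqP; apply/negP.
Qed.

Section IncidenceRingTheory.
Context {d : Order.disp_t} {X : lfPOrderType d} {R : pzRingType}.
Implicit Types f g h : incidence X R.

Fact diag_unit_subproof (u : X) (r : R) x y :
  ~~ (x <= y)%O -> (if (x == u) && (y == u) then r else 0) = 0.
Proof. by case: eqVneq => [->|//]; case: eqVneq => [->|//]; rewrite lexx. Qed.

(** The scaled matrix unit [r e_uu]: as a left factor it isolates row [u], as a right factor column
    [u]. *)
Definition diag_unit (u : X) (r : R) : incidence X R :=
  Incidence (diag_unit_subproof u r).

Lemma incidence_mulE f g x y :
  (f * g) x y = \sum_(z <- interval_seq x y) f x z * g z y.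
Proof. exact: (convolutionE f g (lexx x) (lexx y)). Qed.

Lemma diag_unit_mull u r f x y :
  (diag_unit u r * f) x y = if x == u then r * f u y else 0.
Proof.
have [xy|xy] := boolP (x <= y)%O; last first.
  by rewrite incidenceP//; case: eqVneq => // <-; rewrite incidenceP// mulr0.
rewrite incidence_mulE; case: (eqVneq x u) xy => [->|xu] xy; last first.
  by rewrite big1// => z _; rewrite /= (negbTE xu) mul0r.
rewrite (bigD1_seq u) ?mem_interval_seq ?lexx ?xy ?interval_seq_uniq//=.
by rewrite eqxx big1 ?addr0// => z /negbTE ->; rewrite mul0r.
Qed.

Lemma diag_unit_mulr u r f x y :
  (f * diag_unit u r) x y = if y == u then f x u * r else 0.
Proof.
have [xy|xy] := boolP (x <= y)%O; last first.
  by rewrite incidenceP//; case: eqVneq => // <-; rewrite incidenceP// mul0r.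
rewrite incidence_mulE; case: (eqVneq y u) xy => [->|yu] xy; last first.
  by rewrite big1// => z _; rewrite /= (negbTE yu) andbF mulr0.
rewrite (bigD1_seq u) ?mem_interval_seq ?lexx ?xy ?interval_seq_uniq//=.
by rewrite eqxx big1 ?addr0// => z /negbTE ->; rewrite mulr0.
Qed.

Lemma incidence_neq0P f : f != 0 <-> exists x y, f x y != 0.
Proof.
split=> [f0|[x [y fxy]]]; last by apply: contra_neq fxy => ->.
apply: contrapT => nf; move/eqP: f0; apply; apply: incidence_eqP => x y.
by apply: contrapT => /eqP fxy; apply: nf; exists x, y.
Qed.

Lemma Singl_row_annihilator f (F : X -> R) (s : seq (X * X)) :
    incidence_in X (Singl R) f -> (exists v, F v != 0) ->
  exists2 r, (exists v, r * F v != 0)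
           & forall p, p \in s -> r * F p.1 * f p.1 p.2 = 0.
Proof.
move=> fS F0; elim: s => [|p s [r rF0 rs]].
  by exists 1 => //; case: F0 => v Fv; exists v; rewrite mul1r.
have [rFp|rFp] := eqVneq (r * F p.1) 0.
  exists r => // q; rewrite inE => /orP[/eqP ->|/rs//].
  by rewrite rFp mul0r.
have [t tF0 tf0] := (SinglP _ _).1 (fS p.1 p.2) _ rFp.
(* Left multiplication by [t] preserves the equations already obtained for [s]. *)
exists (t * r) => [|q]; first by exists p.1; rewrite -mulrA.
rewrite inE => /orP[/eqP ->|/rs rq]; first by rewrite -(mulrA t).
by rewrite -!mulrA (mulrA r) rq mulr0.
Qed.

Lemma FS_sub_Singl :
  FS (incidence_in X (Singl R)) `<=` Singl (incidence X R).
Proof.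
move=> f [fS /finite_seqP[s fs]]; apply/SinglP => h /incidence_neq0P[u hu].
have [r [v rv] rs] := Singl_row_annihilator f (h u) s fS hu.
(* All rows of [h] other than [u] are discarded, so annihilating this single row suffices. *)
exists (diag_unit u r).
  by apply/incidence_neq0P; exists u, v; rewrite diag_unit_mull eqxx.
apply: incidence_eqP => x y; rewrite incidence_mulE big1// => z _.
rewrite diag_unit_mull; case: ifP => _; last by rewrite mul0r.
(* Each term vanishes separately, either off the support or by the choice of [r]; hence one [r]
   serves all columns [y]. *)
have [->|fzy] := eqVneq (f z y) 0; first by rewrite mulr0.
have : incidence_support f (z, y) by [].
by rewrite fs => /rs.
Qed.

Lemma Singl_sub_incidence_in :
  Singl (incidence X R) `<=` incidence_in X (Singl R).
Proof.
move=> f /SinglP fS x y; apply/SinglP => b b0.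
have /fS[g] : diag_unit x b != 0.
  by apply/incidence_neq0P; exists x, x; rewrite /= eqxx.
move=> /incidence_neq0P[u [v]]; rewrite diag_unit_mulr.
(* The product lives in column [x], which forces [v = x]. *)
case: ifP => [_ gb0 gbf|]; last by rewrite eqxx.
exists (g u x) => //.
have E : (g * diag_unit x b * f) u y = 0 by rewrite gbf.
(* Unless [u <= x <= y], a factor is zero. Otherwise [x] lies in the interval from [u] to [y], and
   [z = x] gives the only surviving term of [E]. *)
have [xy|xy] := boolP (x <= y)%O; last by rewrite (incidenceP f)// mulr0.
have [ux|ux] := boolP (u <= x)%O; last by rewrite (incidenceP g)// !mul0r.
move: E; rewrite -mulrA incidence_mulE.
rewrite (bigD1_seq x) ?mem_interval_seq ?ux ?xy ?interval_seq_uniq//.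
rewrite diag_unit_mull eqxx mulrA big1 => [|z zx]; first by rewrite /= addr0.
by rewrite diag_unit_mull (negbTE zx) mulr0.
Qed.

End IncidenceRingTheory.

Local Close Scope ring_scope.

Theorem theorem2p0p4 (d : Order.disp_t) (X : lfPOrderType d) (R : pzRingType) :
  FS (incidence_in X (Singl R)) `<=` Singl (incidence X R) /\
  Singl (incidence X R) `<=` incidence_in X (Singl R).
Proof. by split; [exact: FS_sub_Singl | exact: Singl_sub_incidence_in]. Qed.
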